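(* Let $\mathcal{M}$ be the set of all Marshall copulas. Then every $C\in\mathcal{M}$ satisfies $\mu_\infty(C)\le\frac{4}{27}$, and the bound is attained by some Marshall copula, i.e. $\mu_\infty(\mathcal{M}):=\sup_{C\in\mathcal{M}}\mu_\infty(C)=\frac{4}{27}$. The maximal asymmetry function $d^*_{\mathcal{M}}(x,y)=\sup_{C\in\mathcal{M}}|C(x,y)-C(y,x)|$ is given for $x,y\in[0,1]$ by $$d^*_{\mathcal{M}}(x,y)=\begin{cases}x(1-y); & \text{if } x\le y^2,\\ \frac{x}{y}(y-x); & \text{if } y^2\le x\le y,\\ y(1-x); & \text{if } y\le x^2,\\ \frac{y}{x}(x-y); & \text{if } x^2\le y\le x.\end{cases}$$
   Context: A (bivariate) copula is a function $C:[0,1]^2\to[0,1]$ such that $C(x,0)=0=C(0,y)$, $C(x,1)=x$, $C(1,y)=y$ for all $x,y\in[0,1]$, and $C(x_2,y_2)-C(x_2,y_1)-C(x_1,y_2)+C(x_1,y_1)\ge 0$ whenever $0\le x_1\le x_2\le1$ and $0\le y_1\le y_2\le 1$. For a copula $C$, $\mu_\infty(C)=\max_{x,y\in[0,1]}|C(x,y)-C(y,x)|$. A Marshall copula is a copula of the form $C(x,y)=\min\{yf(x),xg(y)\}$, where $f,g:[0,1]\to[0,1]$ are nondecreasing functions (not necessarily continuous at $0$) with $f(0)=g(0)=0$, $f(1)=g(1)=1$, and such that $f^*(x)=\frac{f(x)}{x}$ and $g^*(x)=\frac{g(x)}{x}$ are nonincreasing (with $f^*(0)=\lim_{x\downarrow0}f(x)/x$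 if this limit exists and $f^*(0)=\infty$ otherwise, similarly for $g^*$; so the condition amounts to monotonicity on $(0,1]$). In the piecewise formula, overlapping cases give the same value; at $(0,0)$ the value is $0$ (first case). *)

(* Defs.v *)
From HB Require Import structures.
From mathcomp Require Import all_boot all_order all_algebra.
From mathcomp Require Import all_classical all_reals all_analysis.
From mathcomp Require Import ring lra.

Set Implicit Arguments.
Unset Strict Implicit.
Unset Printing Implicit Defensive.

Import Order.TTheory GRing.Theory Num.Theory.
Import numFieldNormedType.Exports.

Local Open Scope classical_set_scope.
Local Open Scope ring_scope.

(* Functions on [0, 1] and [0, 1]^2 are represented by total functions on R and
   R * R; all conditions and quantities below only involve their values on
   [0, 1], resp. [0, 1]^2. *)

Definition is_copula (R : realType) (C : R -> R -> R) : Prop :=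
  [/\ forall x y, 0 <= x <= 1 -> 0 <= y <= 1 -> 0 <= C x y <= 1,
      forall x, 0 <= x <= 1 -> C x 0 = 0 /\ C 0 x = 0,
      forall x, 0 <= x <= 1 -> C x 1 = x /\ C 1 x = x
    & forall x1 x2 y1 y2, 0 <= x1 -> x1 <= x2 -> x2 <= 1 ->
        0 <= y1 -> y1 <= y2 -> y2 <= 1 ->
        0 <= C x2 y2 - C x2 y1 - C x1 y2 + C x1 y1].

(* f^*(x) = f(x) / x, extended to 0 by the right limit when that limit exists
   in R, and by +oo otherwise. *)
Definition star (R : realType) (f : R -> R) (x : R) : \bar R :=
  if x == 0 then
    if `[< cvg (f t / t @[t --> (0 : R)^'+]) >]
    then (lim (f t / t @[t --> (0 : R)^'+]))%:E
    else +oo%E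
  else (f x / x)%:E.

Definition is_marshall_generator (R : realType) (f : R -> R) : Prop :=
  [/\ forall x, 0 <= x <= 1 -> 0 <= f x <= 1,
      forall x y, 0 <= x -> x <= y -> y <= 1 -> f x <= f y,
      f 0 = 0,
      f 1 = 1
    & forall x y, 0 <= x -> x <= y -> y <= 1 -> (star f y <= star f x)%E].

Definition marshall_copulas (R : realType) : set (R -> R -> R) :=
  [set C | is_copula C /\
     exists f g, [/\ is_marshall_generator f, is_marshall_generator g
       & forall x y, 0 <= x <= 1 -> 0 <= y <= 1 ->
           C x y = Num.min (y * f x) (x * g y)]].

(* For a copula this supremum is a maximum: see mu_infty_max. *)
Definition mu_infty (R : realType) (C : R -> R -> R) : R :=
  sup [set `|C x y - C y x| | x in `[0, 1] & y in `[0, 1]].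

Definition max_asymmetry (R : realType) (M : set (R -> R -> R)) (x y : R) : R :=
  sup [set `|C x y - C y x| | C in M].

Arguments marshall_copulas R : clear implicits.

Lemma copula_lip (R : realType) (C : R -> R -> R) (x x' y y' : R) :
  is_copula C -> 0 <= x <= 1 -> 0 <= x' <= 1 -> 0 <= y <= 1 -> 0 <= y' <= 1 ->
  `|C x y - C x' y'| <= `|x - x'| + `|y - y'|.
Proof.
move=> [_ C0 C1 C2] x01 x'01 y01 y'01.
have lip1 a b c : 0 <= a <= 1 -> 0 <= b <= 1 -> 0 <= c <= 1 ->
    `|C a c - C b c| <= `|a - b|.
  wlog ab : a b / b <= a => [hw a01 b01 c01|].
    have [ba|/ltW ab] := leP b a; first exact: hw.
    by rewrite (distrC (C a c)) (distrC a); exact: hw.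
  move=> /andP[a0 a1] /andP[b0 b1] /andP[c0 c1].
  have := C2 b a 0 c b0 ab a1 (lexx _) c0 c1.
  have := C2 b a c 1 b0 ab a1 c0 c1 (lexx _).
  have [-> _] := C1 a (introT andP (conj a0 a1)).
  have [-> _] := C1 b (introT andP (conj b0 b1)).
  have [-> _] := C0 a (introT andP (conj a0 a1)).
  have [-> _] := C0 b (introT andP (conj b0 b1)).
  by move=> h1 h2; rewrite !ger0_norm; lra.
have lip2 a b c : 0 <= a <= 1 -> 0 <= b <= 1 -> 0 <= c <= 1 ->
    `|C c a - C c b| <= `|a - b|.
  wlog ab : a b / b <= a => [hw a01 b01 c01|].
    have [ba|/ltW ab] := leP b a; first exact: hw.
    by rewrite (distrC (C c a)) (distrC a); exact: hw.
  move=> /andP[a0 a1] /andP[b0 b1] /andP[c0 c1].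
  have := C2 0 c b a (lexx _) c0 c1 b0 ab a1.
  have := C2 c 1 b a c0 c1 (lexx _) b0 ab a1.
  have [_ ->] := C1 a (introT andP (conj a0 a1)).
  have [_ ->] := C1 b (introT andP (conj b0 b1)).
  have [_ ->] := C0 a (introT andP (conj a0 a1)).
  have [_ ->] := C0 b (introT andP (conj b0 b1)).
  by move=> h1 h2; rewrite !ger0_norm; lra.
rewrite (le_trans (ler_distD (C x' y) _ _))// lerD//; [exact: lip1|exact: lip2].
Qed.

Lemma mu_infty_max (R : realType) (C : R -> R -> R) : is_copula C ->
  exists x y, [/\ 0 <= x <= 1, 0 <= y <= 1, mu_infty C = `|C x y - C y x|
    & forall x' y', 0 <= x' <= 1 -> 0 <= y' <= 1 ->
        `|C x' y' - C y' x'| <= `|C x y - C y x|].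
Proof.
move=> cC; pose A : set (R * R) := `[0, 1] `*` `[0, 1].
pose F (p : R * R) : R := `|C p.1 p.2 - C p.2 p.1|.
have AE p : A p <-> (0 <= p.1 <= 1) /\ (0 <= p.2 <= 1).
  by rewrite /A/= !in_itv/=.
have A0 : A !=set0 by exists (0, 0); apply/AE; rewrite /= lexx ler01.
have cA : compact A by apply: compact_setX; exact: segment_compact.
have cF : {within A, continuous F}.
  apply/subspace_continuousP => p /AE[p1 p2].
  apply/cvgrPdist_le => e e0; rewrite near_withinE.
  have e4 : 0 < e / 4 by rewrite divr_gt0.
  near=> q => /AE[q1 q2].
  have : `|p - q| < e / 4.
    by near: q; exact: (@cvgr_dist_lt _ _ _ (nbhs p) _ id p _ _ e4).
  rewrite prod_normE gt_max => /andP[/= h1 h2].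
  rewrite (le_trans (ler_dist_dist _ _))//.
  have := copula_lip cC p1 q1 p2 q2; have := copula_lip cC p2 q2 p1 q1.
  have -> : C p.1 p.2 - C p.2 p.1 - (C q.1 q.2 - C q.2 q.1) =
    (C p.1 p.2 - C q.1 q.2) - (C p.2 p.1 - C q.2 q.1) by ring.
  move=> k1 k2; rewrite (le_trans (ler_normB _ _))//; lra.
have [[x y] + mx] := compact_EVT_max A0 cA cF.
rewrite inE => /AE[/= x01 y01].
have {}mx x' y' : 0 <= x' <= 1 -> 0 <= y' <= 1 ->
    `|C x' y' - C y' x'| <= `|C x y - C y x|.
  by move=> x'1 y'1; apply: (mx (x', y')); rewrite inE; apply/AE.
exists x, y; split => //.
apply/eqP; rewrite eq_le; apply/andP; split.
  apply: ge_sup; first by exists `|C x y - C y x|, x; rewrite ?in_itv//=; exists y; rewrite ?in_itv.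
  by move=> _ [a + [b + <-]]; rewrite /= !in_itv/=; exact: mx.
apply: ub_le_sup.
  by exists `|C x y - C y x| => _ [a + [b + <-]]; rewrite /= !in_itv/=; exact: mx.
by exists x; rewrite /= ?in_itv//; exists y; rewrite /= ?in_itv.
Unshelve. all: by end_near. Qed.

(* Main.v *)
Require Import Defs.
From HB Require Import structures.
From mathcomp Require Import all_boot all_order all_algebra.
From mathcomp Require Import all_classical all_reals all_analysis.
From mathcomp Require Import ring lra.
Import Order.TTheory GRing.Theory Num.Theory.
Import numFieldNormedType.Exports.
Local Open Scope classical_set_scope.
Local Open Scope ring_scope.

(** Let 0 < x <= y. Monotonicity of g^* gives x g(y) <= y g(x), so
    C(x,y) - C(y,x) can only be positive when C(y,x) = x f(y), and then
    f(y) >= y and f(y) >= f(x), together with C(x,y) <= min(y f(x), x), bound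
    it by x (1 - m) with m = max(y, x/y); swapping f and g bounds
    C(y,x) - C(x,y). Since x <= m^2, the bound is at most m^2 (1 - m) <= 4/27.
    It is attained by the generators f(t) = max(m, t) and g(t) = 1 for t > 0,
    which jump at 0. *)

Section MarshallGenerators.
Set Implicit Arguments.
Unset Strict Implicit.
Unset Printing Implicit Defensive.
Context {R : realType}.
Implicit Types (f g : R -> R) (C : R -> R -> R) (a b m t x y : R).

(** * Marshall generators *)

Lemma generator_star_le f x y : is_marshall_generator f ->
  0 < x -> x <= y -> y <= 1 -> x * f y <= y * f x.
Proof.
move=> [_ _ _ _ fs] x0 xy y1; have y0 := lt_le_trans x0 xy.
have := fs x y (ltW x0) xy y1.
rewrite /star !gt_eqF// lee_fin ler_pdivrMr// mulrAC ler_pdivlMr//.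
by rewrite mulrC (mulrC (f x)).
Qed.

(** The nonincreasing quotient [f t / t] equals 1 at [t = 1]. *)
Lemma generator_ge f x : is_marshall_generator f -> 0 < x -> x <= 1 -> x <= f x.
Proof.
move=> fM x0 x1; have [_ _ _ f1 _] := fM.
by have := generator_star_le fM x0 x1 (lexx _); rewrite f1 mulr1 mul1r.
Qed.

(* The value of [star] at [0] imposes nothing: if the right limit exists, it
   dominates the quotients by monotonicity. *)
Lemma star_nonincreasing f :
  (forall x y, 0 < x -> x <= y -> y <= 1 -> f y / y <= f x / x) ->
  forall x y, 0 <= x -> x <= y -> y <= 1 -> (star f y <= star f x)%E.
Proof.
move=> fs x y; rewrite le_eqVlt => /predU1P[<-|x0] xy y1; last first.
  by rewrite /star !gt_eqF ?(lt_le_trans x0)// lee_fin fs.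
have [->//|yN0] := eqVneq y 0.
have y0 : 0 < y by rewrite lt_neqAle eq_sym yN0.
rewrite /star eqxx (negPf yN0); case: ifPn => [/asboolP cf|_]; last by rewrite leey.
rewrite lee_fin; apply: limr_ge => //; near=> t; apply: fs => //.
by near: t; exact: nbhs_right_le.
Unshelve. all: by end_near. Qed.

(** * Upper bounds for the asymmetry *)

Lemma marshall_asymmetry_le f g x y :
  is_marshall_generator f -> is_marshall_generator g ->
  0 < x -> x <= y -> y <= 1 ->
  Num.min (y * f x) (x * g y) - Num.min (x * f y) (y * g x)
    <= x * (1 - Num.max y (x / y)).
Proof.
move=> fM gM x0 xy y1; have y0 := lt_le_trans x0 xy.
have x1 := le_trans xy y1.
set m := Num.max _ _.
have m1 : m <= 1 by rewrite ge_max y1 ler_pdivrMr// mul1r.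
have gxy := generator_star_le gM x0 xy y1.
have fy := generator_ge fM y0 y1.
have [g01 _ _ _ _] := gM; have [f01 fn _ _ _] := fM.
have /andP[_ gy1] : 0 <= g y <= 1 by apply: g01; rewrite ltW.
have fxy : f x <= f y by apply: fn => //; exact: ltW.
have le1 : Num.min (y * f x) (x * g y) <= y * f x by rewrite ge_min lexx.
have le2 : Num.min (y * f x) (x * g y) <= x * g y by rewrite ge_min lexx orbT.
(* If the second minimum is [y * g x], it dominates [x * g y], hence the first minimum, and the
   difference is at most 0. *)
have [_|_] := leP (x * f y) (y * g x); last first.
  by rewrite (@le_trans _ _ 0) ?subr_le0 ?(le_trans le2)// mulr_ge0 ?subr_ge0// ltW.
have xgy : x * g y <= x by rewrite ger_pMr.
have xfy : x * f x <= x * f y by rewrite ler_pM2l.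
have [yx|xy2] := leP (x / y) y.
  have -> : m = y by apply/max_idPl.
  have : x * y <= x * f y by rewrite ler_pM2l.
  lra.
have -> : m = x / y by apply/max_idPr; exact: ltW.
have xE : y * (x / y) = x by rewrite mulrCA divff ?gt_eqF// mulr1.
(* For small [f x], the difference is at most [y * f x - x * f y <= (y - x) * f x], and
   [(y - x) * (x / y) = x * (1 - x / y)]. For large [f x], bound the first minimum by [x] and use
   [f y >= f x >= x / y]. *)
have [fx|/ltW fx] := leP (f x) (x / y).
  have : (y - x) * f x <= (y - x) * (x / y) by rewrite ler_wpM2l// subr_ge0.
  lra.
have : x * (x / y) <= x * f x by rewrite ler_pM2l.
lra.
Qed.

Lemma marshall_asymmetry C x y : marshall_copulas R C ->
  0 <= x -> x <= y -> y <= 1 ->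
  `|C x y - C y x| <= x * (1 - Num.max y (x / y)).
Proof.
move=> [[_ C0 _ _] [f [g [fM gM CE]]]].
rewrite le_eqVlt => /predU1P[<-|x0] xy y1.
  have [-> ->] : C y 0 = 0 /\ C 0 y = 0 by apply: C0; rewrite xy.
  by rewrite subrr normr0 mul0r.
have y0 := lt_le_trans x0 xy; have x1 := le_trans xy y1.
rewrite !CE ?(ltW x0) ?(ltW y0)// ler_norml lerNl opprB.
rewrite (minC (x * f y)) (minC (y * f x)); apply/andP; split.
  exact: marshall_asymmetry_le.
rewrite (minC (x * g y)) (minC (y * g x)).
exact: marshall_asymmetry_le.
Qed.

Lemma asymmetry_bound_le x y : 0 <= x -> x <= y -> y <= 1 ->
  x * (1 - Num.max y (x / y)) <= 4 / 27.
Proof.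
move=> x0 xy y1; have [y0|y0] := leP y 0.
  by have -> : x = 0 by [lra]; rewrite mul0r; lra.
set m := Num.max _ _.
have m1 : m <= 1 by rewrite ge_max y1 ler_pdivrMr// mul1r.
have ym : y <= m by rewrite le_max lexx.
have xym : x / y <= m by rewrite le_max lexx orbT.
(* [x] is the product of [x / y] and [y], both at most [m]. *)
have xm2 : x <= m ^+ 2.
  rewrite -(divfK (lt0r_neq0 y0) x) expr2 ler_pM//; first exact: divr_ge0 (ltW y0).
  exact: ltW.
rewrite (@le_trans _ _ (m ^+ 2 * (1 - m)))// ?ler_wpM2r ?subr_ge0//.
(* This is [27 * (4 / 27 - m ^+ 2 * (1 - m))] in factored form; the double root [2 / 3] is the
   maximiser. *)
have : 0 <= (3 * m - 2) ^+ 2 * (3 * m + 1).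
  by rewrite mulr_ge0 ?sqr_ge0//; lra.
have -> : (3 * m - 2) ^+ 2 * (3 * m + 1) = 27 * m ^+ 3 - 27 * m ^+ 2 + 4 by ring.
have -> : m ^+ 2 * (1 - m) = m ^+ 2 - m ^+ 3 by ring.
lra.
Qed.

(** * The extremal copulas *)

(** On [0, 1], [m = 1] gives the indicator of (0, 1], so both generators of the extremal copula
    belong to this family. *)
Definition jump_generator m x := if x == 0 then 0 else Num.max m x.

Lemma jump_generatorE m x : 0 < x -> jump_generator m x = Num.max m x.
Proof. by rewrite /jump_generator => /gt_eqF ->. Qed.

Lemma jump_generatorP m : 0 <= m <= 1 ->
  is_marshall_generator (jump_generator m).
Proof.
move=> /andP[m0 m1]; split.
- move=> x /andP[x0 x1]; rewrite /jump_generator.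
  by case: ifP => _; rewrite ?lexx ?ler01// le_max ge_max m0 m1 x1.
- move=> x y; rewrite le_eqVlt => /predU1P[<-|x0] xy y1.
    by rewrite {1}/jump_generator eqxx /jump_generator; case: ifP; rewrite // le_max m0.
  rewrite !jump_generatorE ?(lt_le_trans x0)//.
  by rewrite ge_max !le_max lexx xy orbT.
- by rewrite /jump_generator eqxx.
- by rewrite jump_generatorE//; exact/max_idPr.
- apply: star_nonincreasing => x y x0 xy y1; have y0 := lt_le_trans x0 xy.
  rewrite !jump_generatorE// ler_pdivrMr// mulrAC ler_pdivlMr//.
  rewrite (maxr_pMl _ _ (ltW x0)) (maxr_pMl _ _ (ltW y0)).
  rewrite ge_max !le_max ler_wpM2l//=.
  by rewrite (mulrC y x) lexx orbT.
Qed.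

(** The Marshall copula of [jump_generator m] and [jump_generator 1]. No case distinction at 0 is
    left, because the minimum already vanishes there. For [x >= m] it is the product copula. *)
Definition jump_copula m x y := Num.min x (y * Num.max m x).

Lemma jump_copula_le m x y : x <= m -> jump_copula m x y = Num.min x (y * m).
Proof. by rewrite /jump_copula => /max_idPl ->. Qed.

Lemma jump_copula_ge m x y : m <= x -> 0 <= x -> y <= 1 ->
  jump_copula m x y = y * x.
Proof.
by rewrite /jump_copula => /max_idPr -> x0 y1; apply/min_idPr; rewrite ler_piMl.
Qed.

Lemma jump_copulaP m : 0 <= m <= 1 -> is_copula (jump_copula m).
Proof.
move=> /andP[m0 m1]; split.
- move=> x y /andP[x0 x1] /andP[y0 y1]; rewrite /jump_copula.
  by rewrite le_min ge_min x0 x1 mulr_ge0// le_max m0.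
- move=> x /andP[x0 x1]; rewrite /jump_copula mul0r; split.
    exact/min_idPr.
  by apply/min_idPl; rewrite mulr_ge0// le_max m0.
- move=> x /andP[x0 x1]; rewrite /jump_copula mul1r; split.
    by apply/min_idPl; rewrite le_max lexx orbT.
  by rewrite (max_idPr m1) mulr1; exact/min_idPr.
move=> x1 x2 y1 y2 x10 x12 x21 y10 y12 y21.
have x20 := le_trans x10 x12; have y11 := le_trans y12 y21.
have ym : y1 * m <= y2 * m by rewrite ler_wpM2r.
have [x2m|/ltW mx2] := leP x2 m.
  rewrite !jump_copula_le ?(le_trans x12)//.
  by case: (leP x2 (y2 * m)); case: (leP x2 (y1 * m));
     case: (leP x1 (y2 * m)); case: (leP x1 (y1 * m)); lra.
rewrite !(jump_copula_ge mx2)//.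
have [x1m|/ltW mx1] := leP x1 m.
  (* For [x1 <= m <= x2], the increment in [y] is [(y2 - y1) * x2] at [x2], and at most
     [(y2 - y1) * m] at [x1]. *)
  have : (y2 - y1) * m <= (y2 - y1) * x2 by rewrite ler_wpM2l// subr_ge0.
  rewrite !jump_copula_le//.
  by case: (leP x1 (y2 * m)); case: (leP x1 (y1 * m)); lra.
have : (y2 - y1) * x1 <= (y2 - y1) * x2 by rewrite ler_wpM2l// subr_ge0.
rewrite !jump_copula_ge//; lra.
Qed.

Lemma jump_copula_marshall m : 0 <= m <= 1 -> marshall_copulas R (jump_copula m).
Proof.
move=> m01; split; first exact: jump_copulaP.
exists (jump_generator m), (jump_generator 1); split.
- exact: jump_generatorP.
- by apply: jump_generatorP; rewrite ler01 lexx.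
move=> x y /andP[x0 x1] /andP[y0 y1]; have /andP[m0 m1] := m01.
rewrite /jump_copula; have [->|xN0] := eqVneq x 0.
  rewrite /jump_generator eqxx mul0r mulr0 minxx.
  by apply/min_idPl; rewrite mulr_ge0// le_max m0.
rewrite jump_generatorE ?lt0r ?xN0//.
have [->|yN0] := eqVneq y 0.
  by rewrite /jump_generator eqxx !mul0r mulr0 minxx; exact/min_idPr.
by rewrite jump_generatorE ?lt0r ?yN0// (max_idPl y1) mulr1 minC.
Qed.

(** This [m] is large enough that both arguments lie below the kink and [x <= y * m], so the two
    values are [x] and [x * m]. *)
Lemma jump_copula_asymmetry x y (m := Num.max y (x / y)) :
  0 < x -> x <= y -> y <= 1 ->
  jump_copula m x y - jump_copula m y x = x * (1 - m).
Proof.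
move=> x0 xy y1; have y0 := lt_le_trans x0 xy.
have ym : y <= m by rewrite le_max lexx.
have xym : x / y <= m by rewrite le_max lexx orbT.
have m1 : m <= 1 by rewrite ge_max y1 ler_pdivrMr// mul1r.
rewrite !jump_copula_le ?(le_trans xy)//.
rewrite (min_idPl _); last by rewrite mulrC -ler_pdivrMr.
rewrite (min_idPr _) ?mulrBr ?mulr1//.
by rewrite (le_trans _ xy)// ger_pMr.
Qed.

(** * The maximal asymmetry function *)

Lemma max_asymmetryE x y : 0 <= x -> x <= y -> y <= 1 ->
  max_asymmetry (marshall_copulas R) x y = x * (1 - Num.max y (x / y)).
Proof.
move=> x0 xy y1; pose m := Num.max y (x / y).
have m01 : 0 <= m <= 1.
  rewrite le_max (le_trans x0 xy)/= ge_max y1/=.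
  (* Division by 0 yields 0, so [x / y <= 1] also holds at [y = 0]. *)
  have [->|yN0] := eqVneq y 0; first by rewrite invr0 mulr0.
  by rewrite ler_pdivrMr ?mul1r// lt0r yN0 (le_trans x0).
have jM := jump_copula_marshall m01.
have ub : ubound [set `|C x y - C y x| | C in marshall_copulas R]
    (x * (1 - m)) by move=> _ [C CM <-]; exact: marshall_asymmetry.
apply/eqP; rewrite eq_le; apply/andP; split.
  by apply: ge_sup => //; eexists; exists (jump_copula m).
have [x00|x00] := leP x 0; last first.
  apply: ub_le_sup; first by exists (x * (1 - m)).
  exists (jump_copula m) => //; rewrite jump_copula_asymmetry//.
  by rewrite ger0_norm// mulr_ge0// subr_ge0; case/andP: m01.
have -> : x = 0 by lra.
(* At [x = 0] the claimed value is 0, and any member of the set bounds the supremum below by a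
   nonnegative number. *)
rewrite mul0r (le_trans (normr_ge0 (jump_copula m 0 y - jump_copula m y 0)))//.
apply: ub_le_sup; last by exists (jump_copula m).
by have <- : x = 0 by [lra]; exists (x * (1 - m)).
Qed.

(** Reduces the cases [y <= x] of the formula to [x <= y]. *)
Lemma max_asymmetryC (M : set (R -> R -> R)) x y :
  max_asymmetry M x y = max_asymmetry M y x.
Proof.
by congr sup; apply/seteqP; split => _ [C CM <-]; exists C; rewrite 1?distrC.
Qed.

(** Comparing [x] with [y ^+ 2] decides which of [y] and [x / y] is the maximum. *)
Lemma max_asymmetry_piecewise x y : 0 <= x -> 0 <= y <= 1 ->
  (x <= y ^+ 2 ->
     max_asymmetry (marshall_copulas R) x y = x * (1 - y)) /\
  (y ^+ 2 <= x <= y ->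
     max_asymmetry (marshall_copulas R) x y = x / y * (y - x)).
Proof.
move=> x0 /andP[y0 y1]; split=> [xy2|/andP[y2x xy]].
  have xy : x <= y by rewrite (le_trans xy2)// expr2 ler_piMl.
  rewrite max_asymmetryE// (max_idPl _)//.
  have [->|yN0] := eqVneq y 0; first by rewrite invr0 mulr0.
  by rewrite ler_pdivrMr -?expr2// lt0r yN0.
rewrite max_asymmetryE//.
have [yE0|yN0] := eqVneq y 0.
  by have -> : x = 0 by [lra]; rewrite !mul0r.
have yp : 0 < y by rewrite lt0r yN0.
rewrite (max_idPr _); last by rewrite ler_pdivlMr// -expr2.
by field.
Qed.

(** * The sharp constant *)

Lemma mu_infty_marshall_le C : marshall_copulas R C -> mu_infty C <= 4 / 27.
Proof.
move=> CM; have [x [y [/andP[x0 x1] /andP[y0 y1] -> _]]] := mu_infty_max (proj1 CM).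
have [xy|/ltW yx] := leP x y.
  by rewrite (le_trans (marshall_asymmetry CM _ _ _))// asymmetry_bound_le.
rewrite distrC.
by rewrite (le_trans (marshall_asymmetry CM _ _ _))// asymmetry_bound_le.
Qed.

Lemma mu_infty_jump_copula : mu_infty (jump_copula (2 / 3)) = 4 / 27.
Proof.
have jM : marshall_copulas R (jump_copula (2 / 3)).
  by apply: jump_copula_marshall; lra.
apply/eqP; rewrite eq_le mu_infty_marshall_le//=.
have [x [y [_ _ -> le_mu]]] := mu_infty_max (proj1 jM).
(* The point [(4 / 9, 2 / 3)] is [(m ^+ 2, m)] for the maximiser [m = 2 / 3] of [m ^+ 2 * (1 - m)];
   there [y] and [x / y] both equal [m]. *)
have mE : Num.max (2 / 3) (4 / 9 / (2 / 3)) = 2 / 3 :> R.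
  by apply/max_idPl; lra.
have := @jump_copula_asymmetry (4 / 9) (2 / 3); rewrite /= mE => jE.
have -> : 4 / 27 = 4 / 9 * (1 - 2 / 3) :> R by field.
rewrite -jE; [|lra..].
by rewrite (le_trans (ler_norm _))// le_mu//; lra.
Qed.

End MarshallGenerators.

Theorem theorem4p3 (R : realType) :
  [/\ forall C : R -> R -> R, marshall_copulas R C -> mu_infty C <= 4 / 27,
      exists2 C : R -> R -> R, marshall_copulas R C & mu_infty C = 4 / 27,
      sup [set mu_infty C | C in marshall_copulas R] = 4 / 27
    & forall x y : R, 0 <= x <= 1 -> 0 <= y <= 1 ->
        let d := max_asymmetry (marshall_copulas R) x y in
        [/\ x <= y ^+ 2 -> d = x * (1 - y),
            y ^+ 2 <= x <= y -> d = x / y * (y - x),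
            y <= x ^+ 2 -> d = y * (1 - x)
          & x ^+ 2 <= y <= x -> d = y / x * (x - y)]].
Proof.
have jM : marshall_copulas R (jump_copula (2 / 3)).
  by apply: jump_copula_marshall; lra.
split.
- exact: mu_infty_marshall_le.
- by exists (jump_copula (2 / 3)) => //; exact: mu_infty_jump_copula.
- apply/eqP; rewrite eq_le; apply/andP; split.
    apply: ge_sup; first by eexists; exists (jump_copula (2 / 3)).
    by move=> _ [C CM <-]; exact: mu_infty_marshall_le.
  apply: ub_le_sup; last first.
    by exists (jump_copula (2 / 3)) => //; exact: mu_infty_jump_copula.
  by exists (4 / 27) => _ [C CM <-]; exact: mu_infty_marshall_le.
- move=> x y x01 y01 d; have [x0 _] := andP x01; have [y0 _] := andP y01.
  have [d1 d2] := max_asymmetry_piecewise x0 y01.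
  have [d3 d4] := max_asymmetry_piecewise y0 x01.
  by rewrite /d; split=> //; rewrite max_asymmetryC.
Qed.
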